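(* For every $p\in(1,\infty)$ and every $\varepsilon>0$ (with additionally $\varepsilon<p-1$ if $p\in(1,2)$) there exists a constant $C(p,\varepsilon)$, depending only on $p$ and $\varepsilon$ (in particular not on $n$, $d$, $k$ or $f$), such that the following holds for every positive integer $n$, every $d\in[n]$, every $f\in\mathrm{Deg}_{\le d}$ and every $k\in\mathbb{N}$. (i) If $\theta=\theta(\varepsilon,p)\in(0,1)$ satisfies $$\frac1p=\frac{\theta}{p_\varepsilon}+\frac{1-\theta}{2},$$ then $$\|\Delta^k f\|_{L^p(\{-1,1\}^n)}\le C(p,\varepsilon)^k\, d^k\,\|f\|_{L^2(\{-1,1\}^n)}^{1-\theta}\,\|f\|_{L^{p_\varepsilon}(\{-1,1\}^n)}^{\theta}.$$ (ii) If $p\ge 2$, then also $$\|\Delta^k f\|_{L^p(\{-1,1\}^n)}\le C(p,\varepsilon)^k\, d^k\,\|f\|_{L^{p+\varepsilon}(\{-1,1\}^n)}.$$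
   Context: Write $[n]=\{1,\dots,n\}$. The Hamming cube $\{-1,1\}^n$ carries the uniform probability measure, and for $p\in[1,\infty)$ and $f\colon\{-1,1\}^n\to\mathbb{C}$, $\|f\|_{L^p(\{-1,1\}^n)}=\left(2^{-n}\sum_{\delta\in\{-1,1\}^n}|f(\delta)|^p\right)^{1/p}$. For $S\subseteq[n]$ the Walsh function is $w_S(\delta)=\prod_{j\in S}\delta_j$, and each $f\colon\{-1,1\}^n\to\mathbb{C}$ has the Fourier--Walsh expansion $f=\sum_{S\subseteq[n]}\widehat f(S)w_S$ with $\widehat f(S)=2^{-n}\sum_{\delta}f(\delta)w_S(\delta)$. $\mathrm{Deg}_{\le d}$ is the space of functions $f\colon\{-1,1\}^n\to\mathbb{C}$ with $\widehat f(S)=0$ whenever $|S|>d$. The Hamming cube Laplacian is $\Delta f=\sum_{j=1}^n\partial_j f$, where $\partial_j f(\delta)=\frac{f(\delta_1,\dots,\delta_j,\dots,\delta_n)-f(\delta_1,\dots,-\delta_j,\dots,\delta_n)}{2}$; equivalently $\Delta f=\sum_{S\subseteq[n]}|S|\,\widehat f(S)\,w_S$. The exponent $p_\varepsilon$ is defined by $p_\varepsilon=p+\varepsilon$ if $p\ge2$ and $\varepsilon>0$, and $p_\varepsilon=p-\varepsilon$ if $p\in(1,2)$ and $\varepsilon\in(0,p-1)$. *)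

(* Defs.v *)
From mathcomp Require Import all_boot all_order all_algebra.
From mathcomp Require Import all_classical all_reals all_analysis.
From mathcomp Require Import complex.

Set Implicit Arguments.
Unset Strict Implicit.
Unset Printing Implicit Defensive.

Import Order.TTheory GRing.Theory Num.Theory.

Local Open Scope ring_scope.
Local Open Scope complex_scope.

(* The vertex delta of {-1,1}^n is encoded by its sign bits:
   delta_j = (-1) ^+ x j, so the bit true stands for -1. *)
Notation cube n := {ffun 'I_n -> bool}.

Definition flip (n : nat) (j : 'I_n) (x : cube n) : cube n :=
  [ffun i => if i == j then ~~ x i else x i].

Section Cube.
Variables (R : realType) (n : nat).
Implicit Types (f : {ffun cube n -> R[i]}) (S : {set 'I_n}).

Definition cube_norm (p : R) f : R :=
  (2%:R ^- n * \sum_(x : cube n) ComplexField.Normc.normc (f x) `^ p) `^ p^-1.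

Definition walsh S : {ffun cube n -> R[i]} :=
  [ffun x : cube n => \prod_(j in S) (-1) ^+ x j].

Definition fourier_coef f S : R[i] :=
  2%:R ^- n * \sum_(x : cube n) f x * walsh S x.

Definition deg_le (d : nat) f : Prop :=
  forall S, (d < #|S|)%N -> fourier_coef f S = 0.

Definition cube_partial (j : 'I_n) f : {ffun cube n -> R[i]} :=
  [ffun x : cube n => (f x - f (flip j x)) / 2%:R].

Definition laplacian f : {ffun cube n -> R[i]} :=
  \sum_(j < n) cube_partial j f.

End Cube.

Definition p_eps (R : realType) (p eps : R) : R :=
  if 2%:R <= p then p + eps else p - eps.

(* Main.v *)
Require Import Defs.
From mathcomp Require Import all_boot all_order all_algebra.
From mathcomp Require Import all_classical all_reals all_analysis.
From mathcomp Require Import complex.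
From mathcomp Require Import ring lra.

Import Order.TTheory GRing.Theory Num.Theory.
Import numFieldNormedType.Exports.
Local Open Scope ring_scope.
Local Open Scope complex_scope.

(* The resolvent [(1 + s Delta)^-1] is a contraction of every L^q, because
   [Delta = \sum_j (1 - T_j) / 2] where the [T_j] are isometries of L^q.  So
   [X = 1 - (1 + s Delta)^-1] has norm at most [2] on L^q, whereas on functions
   of degree at most [d] its L^2 norm is at most [s d], its eigenvalues being
   [s m / (1 + s m)].  Take [s = a / d] with [a] so small that the interpolated
   bound for [X ^ j] is [2 ^- j].  Then [s Delta = \sum_(j >= 1) X ^ j] and
   [(s Delta) ^ k] is a power series in [X] with nonnegative coefficients, so
   the bound for [(s Delta) ^ k] is the value at [1/2] of
   [(x / (1 - x)) ^ k], that is [1]. *)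

(** * Scalar convexity inequalities *)

Local Notation modc := ComplexField.Normc.normc.

(** Young's inequality with the conjugate exponents [lam^-1] and [(1 - lam)^-1]. It is the pointwise
    source of both Hölder-type bounds below. The endpoint [lam = 1], where the second exponent
    degenerates, is kept because it occurs for [theta = 0] in [cube_norm_interp] and for [q = 2] in
    [cube_norm2_le]. *)
Lemma powR_amgm (R : realType) (u v lam : R) : 0 <= u -> 0 <= v ->
  0 < lam <= 1 -> u `^ lam * v `^ (1 - lam) <= lam * u + (1 - lam) * v.
Proof.
move=> u0 v0 /andP[l0]; rewrite le_eqVlt => /orP[/eqP ->|l1].
  by rewrite subrr powRr1 // powRr0 mulr1 mul1r mul0r addr0.
have l1' : 0 < 1 - lam by rewrite subr_gt0.
have := @conjugate_powR R (u `^ lam) (v `^ (1 - lam)) lam^-1 (1 - lam)^-1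
  (powR_ge0 _ _) (powR_ge0 _ _).
rewrite !invr_gt0 !invrK => /(_ l0 l1'); rewrite addrC subrK => /(_ erefl).
by rewrite -!powRrM !divff ?gt_eqF// !powRr1// mulrC [v * _]mulrC [_ * u]mulrC.
Qed.

Lemma powR_convex (R : realType) (p t x y : R) : 1 <= p ->
  0 <= t -> t <= 1 -> 0 <= x -> 0 <= y ->
  (t * x + (1 - t) * y) `^ p <= t * x `^ p + (1 - t) * y `^ p.
Proof.
move=> p1 t0 t1 x0 y0.
by apply: (convex_powR p1 (Itv01 t0 t1)); rewrite inE /= in_itv /= andbT.
Qed.

(** * Norms on the cube: Minkowski, interpolation and monotonicity in the exponent *)

Section Norms.
Context {R : realType} {n : nat}.
Implicit Types (f g : {ffun cube n -> R[i]}) (u v : cube n -> R) (p q c : R).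

Definition avg u : R := 2%:R ^- n * \sum_x u x.

Lemma ler_avg u v : (forall x, u x <= v x) -> avg u <= avg v.
Proof.
by move=> uv; rewrite /avg ler_wpM2l ?invr_ge0 ?exprn_ge0// ler_sum.
Qed.

Lemma avg_ge0 u : (forall x, 0 <= u x) -> 0 <= avg u.
Proof. by move=> u0; rewrite mulr_ge0 ?invr_ge0 ?exprn_ge0// sumr_ge0. Qed.

Lemma avgD u v : avg (fun x => u x + v x) = avg u + avg v.
Proof. by rewrite /avg big_split mulrDr. Qed.

Lemma avgZ c u : avg (fun x => c * u x) = c * avg u.
Proof. by rewrite /avg -mulr_sumr mulrCA. Qed.

Lemma card_cube : #|{: cube n}| = (2 ^ n)%N.
Proof. by rewrite card_ffun card_bool card_ord. Qed.

Lemma avg1 : avg (fun=> 1) = 1.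
Proof.
by rewrite /avg sumr_const card_cube -natrX mulVf// pnatr_eq0 expn_eq0.
Qed.

Lemma modc_ge0 (z : R[i]) : 0 <= modc z.
Proof. by case: z => a b /=; rewrite sqrtr_ge0. Qed.

Lemma modc_real (c : R) : modc c%:C = `|c|.
Proof. by rewrite /= expr0n addr0 sqrtr_sqr. Qed.

Lemma cube_norm_ge0 p f : 0 <= cube_norm p f.
Proof. exact: powR_ge0. Qed.

Lemma cube_norm_powR p f : 0 < p ->
  cube_norm p f `^ p = avg (fun x => modc (f x) `^ p).
Proof.
move=> p0; rewrite /cube_norm -powRrM mulVf ?gt_eqF// powRr1//.
by apply: avg_ge0 => x; apply: powR_ge0.
Qed.

Lemma cube_norm_le p f c : 0 < p -> 0 <= c ->
  avg (fun x => modc (f x) `^ p) <= c `^ p -> cube_norm p f <= c.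
Proof.
move=> p0 c0 fc; rewrite -[leRHS]powRr1// -[in leRHS](divff (lt0r_neq0 p0)).
rewrite powRrM; apply: ge0_ler_powR => //; rewrite ?nnegrE ?powR_ge0//.
- by rewrite invr_ge0 ltW.
- by apply: avg_ge0 => x; apply: powR_ge0.
Qed.

Lemma cube_norm0 p : 0 < p -> cube_norm p (0 : {ffun cube n -> R[i]}) = 0.
Proof.
move=> p0; apply/eqP; rewrite eq_le cube_norm_ge0 andbT.
apply: cube_norm_le => //.
rewrite /avg big1 ?mulr0 ?powR_ge0// => x _.
by rewrite ffunE ComplexField.Normc.normc0 powR0// gt_eqF.
Qed.

Lemma cube_norm_eq0 p f : 0 < p -> cube_norm p f = 0 -> f = 0.
Proof.
move=> p0 f0; have := cube_norm_powR p f p0; rewrite f0 powR0 ?gt_eqF// => /esym/eqP.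
rewrite mulf_eq0 invr_eq0 expf_eq0 pnatr_eq0 andbF/=.
rewrite psumr_eq0 => [|x _]; last exact: powR_ge0.
move=> /allP h; apply/ffunP => x; rewrite ffunE.
apply: ComplexField.Normc.eq0_normc; apply/eqP.
have := h x (mem_index_enum _); rewrite powR_eq0 => /andP[] //.
Qed.

Lemma cube_normZ p (c : R[i]) f : 0 < p ->
  cube_norm p (c *: f) = modc c * cube_norm p f.
Proof.
move=> p0; rewrite -[RHS]powRr1 ?mulr_ge0 ?modc_ge0 ?cube_norm_ge0//.
rewrite -[in RHS](divff (lt0r_neq0 p0)) powRrM; congr (_ `^ _).
rewrite powRM ?modc_ge0 ?cube_norm_ge0// cube_norm_powR// -avgZ.
rewrite /avg; congr (_ * _); apply: eq_bigr => x _.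
by rewrite ffunE ComplexField.Normc.normcM powRM ?modc_ge0.
Qed.

Lemma cube_normZ_real p c f :
  0 < p -> 0 <= c -> cube_norm p (c%:C *: f) = c * cube_norm p f.
Proof. by move=> p0 c0; rewrite cube_normZ// modc_real ger0_norm. Qed.

(** Minkowski, interpolation and monotonicity are all proved by normalising: a pointwise inequality
    between normalised functions is averaged, and each average on the right becomes [1]. *)
Lemma avg_normalize p f : 0 < p -> 0 < cube_norm p f ->
  avg (fun x => (modc (f x) / cube_norm p f) `^ p) = 1.
Proof.
move=> p0 f0.
have -> : avg (fun x => (modc (f x) / cube_norm p f) `^ p) =
    (cube_norm p f)^-1 `^ p * avg (fun x => modc (f x) `^ p).
  rewrite -avgZ; congr avg; apply/funext => x.
  by rewrite powRM ?modc_ge0 ?invr_ge0 ?cube_norm_ge0// mulrC.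
rewrite -cube_norm_powR// -powRM ?invr_ge0 ?cube_norm_ge0//.
by rewrite mulVf ?gt_eqF// powR1.
Qed.

(* Convexity of [t `^ p] is applied to [|f| / A] and [|g| / B] with weights
   [A / (A + B)] and [B / (A + B)], where [A] and [B] are the two norms. *)
Lemma cube_normD p f g : 1 <= p ->
  cube_norm p (f + g) <= cube_norm p f + cube_norm p g.
Proof.
move=> p1; have p0 : 0 < p by apply: lt_le_trans p1.
have [/esym f0|fgt0] := eqVneq 0 (cube_norm p f).
  by rewrite f0 (cube_norm_eq0 _ _ p0 f0) !add0r.
have [/esym g0|ggt0] := eqVneq 0 (cube_norm p g).
  by rewrite g0 (cube_norm_eq0 _ _ p0 g0) !addr0.
have A0 : 0 < cube_norm p f by rewrite lt_def eq_sym fgt0 cube_norm_ge0.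
have B0 : 0 < cube_norm p g by rewrite lt_def eq_sym ggt0 cube_norm_ge0.
move: (@avg_normalize p f p0 A0) (@avg_normalize p g p0 B0).
move: (cube_norm p f) (cube_norm p g) A0 B0 => A B A0 B0 avgA avgB {fgt0 ggt0}.
have AB0 : 0 < A + B by rewrite addr_gt0.
have AB1 : A + B != 0 by rewrite gt_eqF.
have A1 : A != 0 by rewrite gt_eqF.
have B1 : B != 0 by rewrite gt_eqF.
apply: cube_norm_le => //; first exact: ltW.
pose t := A / (A + B).
have t1 : 1 - t = B / (A + B) by rewrite /t; field.
have t0 : 0 <= t by rewrite ltW// divr_gt0.
have t1' : 0 <= 1 - t by rewrite t1 ltW// divr_gt0.
have tle1 : t <= 1 by rewrite -subr_ge0.
pose F x := modc (f x) / A; pose G x := modc (g x) / B.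
have pw x : modc ((f + g) x) `^ p <=
    (A + B) `^ p * (t * F x `^ p + (1 - t) * G x `^ p).
  have F0 : 0 <= F x by rewrite mulr_ge0 ?modc_ge0 ?invr_ge0 ?(ltW A0).
  have G0 : 0 <= G x by rewrite mulr_ge0 ?modc_ge0 ?invr_ge0 ?(ltW B0).
  have FG0 : 0 <= t * F x + (1 - t) * G x by exact: addr_ge0 (mulr_ge0 t0 F0) (mulr_ge0 t1' G0).
  have fgE : (A + B) * (t * F x + (1 - t) * G x) = modc (f x) + modc (g x).
    rewrite t1 /t /F /G; move: (modc (f x)) (modc (g x)) => a b.
    by field; rewrite A1 B1 AB1.
  apply: (@le_trans _ _ (((A + B) * (t * F x + (1 - t) * G x)) `^ p)).
    rewrite fgE; apply: ge0_ler_powR; rewrite ?nnegrE ?addr_ge0 ?modc_ge0 ?(ltW p0)//.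
    by rewrite ffunE le_normcD.
  rewrite (powRM _ (ltW AB0) FG0) ler_wpM2l ?powR_ge0//.
  exact: powR_convex.
apply: (le_trans (ler_avg _ _ pw)).
by rewrite avgZ avgD !avgZ avgA avgB !mulr1 [t + _]addrC subrK mulr1.
Qed.

Lemma cube_norm_sum p (I : Type) (r : seq I) (F : I -> {ffun cube n -> R[i]}) :
  1 <= p -> cube_norm p (\sum_(i <- r) F i) <= \sum_(i <- r) cube_norm p (F i).
Proof.
move=> p1; elim/big_rec2: _ => [|i c f _ le]; first by rewrite cube_norm0// (lt_le_trans _ p1).
by rewrite (le_trans (cube_normD _ _ _ p1))// lerD2l.
Qed.

Lemma flipK (j : 'I_n) : involutive (@flip n j).
Proof. by move=> x; apply/ffunP => i; rewrite !ffunE; case: eqP => // _; rewrite negbK. Qed.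

Lemma cube_norm_flip p (j : 'I_n) f :
  cube_norm p [ffun x => f (flip j x)] = cube_norm p f.
Proof.
rewrite /cube_norm; congr ((_ * _) `^ _).
rewrite [RHS](reindex_inj (inv_inj (flipK j))).
by apply: eq_bigr => x _; rewrite ffunE.
Qed.

(** Log-convexity of the norms (Hölder): [powR_amgm] is applied at each vertex to [(|f| / A) ^ 2]
    and [(|f| / B) ^ q], where [A] and [B] are the two norms, and then averaged. The value
    [theta = 0] is allowed because [p = 2] leads to it. *)
Lemma cube_norm_interp p q theta f : 0 < p -> 0 < q -> 0 <= theta < 1 ->
  p^-1 = theta / q + (1 - theta) / 2%:R ->
  cube_norm p f <= cube_norm 2%:R f `^ (1 - theta) * cube_norm q f `^ theta.
Proof.
move=> p0 q0 /andP[th0 th1] pE; have two0 : 0 < 2%:R :> R by [].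
have [/esym/(cube_norm_eq0 _ _ two0) ->|Ane0] := eqVneq 0 (cube_norm 2%:R f).
  by rewrite cube_norm0// mulr_ge0 ?powR_ge0.
have [/esym/(cube_norm_eq0 _ _ q0) ->|Bne0] := eqVneq 0 (cube_norm q f).
  by rewrite cube_norm0// mulr_ge0 ?powR_ge0.
have A0 : 0 < cube_norm 2%:R f by rewrite lt_def eq_sym Ane0 cube_norm_ge0.
have B0 : 0 < cube_norm q f by rewrite lt_def eq_sym Bne0 cube_norm_ge0.
move: (avg_normalize _ f two0 A0) (avg_normalize _ f q0 B0).
move: (cube_norm 2%:R f) (cube_norm q f) A0 B0 => A B A0 B0 avgA avgB {Ane0 Bne0}.
apply: cube_norm_le => //; first by rewrite mulr_ge0 ?powR_ge0.
have pne0 : p != 0 by rewrite gt_eqF.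
have qne0 : q != 0 by rewrite gt_eqF.
(* Chosen so that [u ^ lam] below is [(|f| / A) ^ (p (1 - theta))]; the relation between the
   exponents then forces [1 - lam = p theta / q], the matching weight for [v]. *)
pose lam := p * (1 - theta) / 2%:R.
have lamE : 1 - lam = p * theta / q.
  by rewrite -[1](divff pne0) pE /lam; field.
have lam0 : 0 < lam by rewrite divr_gt0// mulr_gt0// subr_gt0.
have lam01 : 0 < lam <= 1.
  rewrite lam0 -subr_ge0 lamE divr_ge0 ?(ltW q0)//.
  by rewrite mulr_ge0 ?(ltW p0).
set C := (_ * _) `^ p.
pose u x := (modc (f x) / A) `^ 2%:R.
pose v x := (modc (f x) / B) `^ q.
have pw x : modc (f x) `^ p <= C * (lam * u x + (1 - lam) * v x).
  have F0 := modc_ge0 (f x).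
  have := powR_amgm R (u x) (v x) lam (powR_ge0 _ _) (powR_ge0 _ _) lam01.
  move=> /(ler_wpM2l (powR_ge0 _ _ : 0 <= C)); apply: le_trans.
  have -> : u x `^ lam = (modc (f x) / A) `^ (1 - theta) `^ p.
    by rewrite /u -!powRrM; congr (_ `^ _); rewrite /lam; field.
  have -> : v x `^ (1 - lam) = (modc (f x) / B) `^ theta `^ p.
    by rewrite /v -!powRrM lamE; congr (_ `^ _); field.
  have FA : 0 <= modc (f x) / A by rewrite divr_ge0 ?(ltW A0).
  have FB : 0 <= modc (f x) / B by rewrite divr_ge0 ?(ltW B0).
  rewrite /C -!powRM ?mulr_ge0 ?powR_ge0// mulrACA.
  rewrite -!powRM ?(ltW A0) ?(ltW B0)//.
  rewrite [A * _]mulrC [B * _]mulrC !divfK ?gt_eqF//.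
  rewrite -powRD ?subrK ?powRr1//.
  by rewrite oner_eq0.
apply: (le_trans (ler_avg _ _ pw)).
by rewrite avgZ avgD !avgZ avgA avgB !mulr1 [lam + _]addrC subrK mulr1.
Qed.

(** The same normalisation argument, with the constant [1] as second factor: this uses that the
    measure is a probability. *)
Lemma cube_norm2_le q f : 2%:R <= q -> cube_norm 2%:R f <= cube_norm q f.
Proof.
move=> q2; have q0 : 0 < q by apply: lt_le_trans q2.
have [/esym/(cube_norm_eq0 _ _ q0) ->|Bne0] := eqVneq 0 (cube_norm q f).
  by rewrite !cube_norm0.
have B0 : 0 < cube_norm q f by rewrite lt_def eq_sym Bne0 cube_norm_ge0.
move: (avg_normalize _ f q0 B0).
move: (cube_norm q f) B0 => B B0 avgB {Bne0}.
apply: cube_norm_le => //; first exact: ltW.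
pose lam := 2%:R / q.
have lam01 : 0 < lam <= 1 by rewrite divr_gt0//= ler_pdivrMr// mul1r.
pose u x := (modc (f x) / B) `^ q.
have pw x : modc (f x) `^ 2%:R <= B `^ 2%:R * (lam * u x + (1 - lam) * 1).
  have FB : 0 <= modc (f x) / B by rewrite divr_ge0 ?modc_ge0 ?(ltW B0).
  have := powR_amgm R (u x) 1 lam (powR_ge0 _ _) ler01 lam01.
  move=> /(ler_wpM2l (powR_ge0 _ _ : 0 <= B `^ 2%:R)); apply: le_trans.
  rewrite powR1 mulr1 /u -powRrM /lam [q * _]mulrC divfK ?gt_eqF//.
  by rewrite -powRM ?(ltW B0)// [B * _]mulrC divfK // gt_eqF.
apply: (le_trans (ler_avg _ _ pw)).
by rewrite avgZ avgD !avgZ avg1 avgB !mulr1 [lam + _]addrC subrK mulr1.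
Qed.

End Norms.

(** * Walsh expansion, Parseval, and multipliers depending on the degree *)

Section Fourier.
Context {R : realType} {n : nat}.
Implicit Types (f g : {ffun cube n -> R[i]}) (S T : {set 'I_n}) (c : nat -> R).

Let two_neq0 : 2%:R ^+ n != 0 :> R[i].
Proof. by rewrite expf_eq0 pnatr_eq0 andbF. Qed.

Lemma walsh_flip S (j : 'I_n) (x : cube n) :
  walsh R S (flip j x) = if j \in S then - walsh R S x else walsh R S x.
Proof.
rewrite !ffunE; case: ifP => jS.
  rewrite (bigD1 j)//= [in RHS](bigD1 j)//= !ffunE eqxx -mulNr; congr (_ * _).
    by case: (x j); rewrite ?expr0 ?expr1 ?opprK.
  by apply: eq_bigr => i /andP[_ /negPf ij]; rewrite ffunE ij.
apply: eq_bigr => i iS; rewrite ffunE; case: eqP => // ij.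
by rewrite -ij iS in jS.
Qed.

Lemma walsh_orth S T :
  \sum_(x : cube n) walsh R S x * walsh R T x = 2%:R ^+ n *+ (S == T).
Proof.
case: eqVneq => [<-|ST].
  rewrite (eq_bigr (fun=> 1)) => [|x _].
    by rewrite sumr_const card_cube natrX.
  rewrite ffunE -big_split big1 //= => j _.
  by rewrite -expr2 sqrr_sign.
have [j jST] : exists j, (j \in S) (+) (j \in T).
  apply/existsP; apply: contraNT ST => /existsPn h.
  by apply/eqP/setP => j; have := h j; case: (j \in S); case: (j \in T).
(* Since [j] lies in exactly one of [S] and [T], flipping coordinate [j] negates every summand, so
   the sum equals its own opposite. *)
apply/eqP; rewrite mulr0n -eqNr; apply/eqP.
rewrite [in RHS](reindex_inj (inv_inj (flipK j))) -sumrN.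
apply: eq_bigr => x _; rewrite !walsh_flip.
by move: jST; case: ifP => _; case: ifP => //= _ _; rewrite ?mulrN ?mulNr.
Qed.

(** The sum over [S] is the expansion of the product over [j] of [1 + x_j y_j], in signs. Each
    factor is [2] if the vertices agree at [j] and [0] otherwise. *)
Lemma walsh_orth_dual (x y : cube n) :
  \sum_S walsh R S x * walsh R S y = 2%:R ^+ n *+ (x == y).
Proof.
pose e (j : 'I_n) : R[i] := (-1) ^+ x j * (-1) ^+ y j.
have -> : \sum_S walsh R S x * walsh R S y = \prod_j (e j + 1).
  rewrite bigA_distr; apply: eq_big => [S|S _]; first by rewrite inE.
  by rewrite !ffunE -big_split /= big_mkcond.
rewrite {}/e; case: eqVneq => [<-|xy].
  rewrite (eq_bigr (fun=> 2%:R)) ?prodr_const ?card_ord// => j _.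
  by rewrite -expr2 sqrr_sign -natr1.
have [j xyj] : exists j, x j != y j.
  apply/existsP; apply: contraNT xy => /existsPn h.
  by apply/eqP/ffunP => j; have /negPn/eqP := h j.
rewrite (bigD1 j)//= mulr0n.
by move: xyj; case: (x j); case: (y j) => // _;
  rewrite ?expr0 ?expr1 ?mulr1 ?mul1r addNr mul0r.
Qed.

Lemma walsh_inversion f x : f x = \sum_S fourier_coef f S * walsh R S x.
Proof.
rewrite /fourier_coef.
under eq_bigr => S _ do rewrite -mulrA mulr_suml.
rewrite -mulr_sumr exchange_big /=.
under eq_bigr => y _.
  under eq_bigr => S _ do rewrite -mulrA.
  rewrite -mulr_sumr walsh_orth_dual. over.
rewrite (bigD1 x)//= eqxx big1 => [|y /negPf xy].
  by rewrite addr0 mulrCA mulVf ?mulr1.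
by rewrite xy mulr0.
Qed.

Lemma fourier_coef_walsh_sum (a : {set 'I_n} -> R[i]) S :
  fourier_coef [ffun x => \sum_T a T * walsh R T x] S = a S.
Proof.
rewrite /fourier_coef; under eq_bigr => x _ do rewrite ffunE mulr_suml.
rewrite exchange_big /=.
under eq_bigr => T _.
  under eq_bigr => x _ do rewrite -mulrA.
  rewrite -mulr_sumr walsh_orth. over.
rewrite (bigD1 S)//= eqxx big1 => [|T /negPf TS].
  by rewrite addr0 mulrCA mulVf ?mulr1.
by rewrite TS mulr0.
Qed.

(** Only the conjugate factor of [f x * (f x)^*] is expanded in Walsh functions; the average over
    [x] of the rest is again a Fourier coefficient. *)
Lemma parseval f :
  cube_norm 2%:R f ^+ 2 = \sum_S modc (fourier_coef f S) ^+ 2.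
Proof.
have sqrE (z : R[i]) : (modc z ^+ 2)%:C = z * z^*%R by rewrite -normCK -rmorphXn.
rewrite -powR_mulrn ?cube_norm_ge0// cube_norm_powR// /avg.
under eq_bigr => x _ do rewrite powR_mulrn ?modc_ge0//.
apply: complexI; rewrite rmorphM /= !rmorph_sum /=.
rewrite rmorphV ?unitfE ?expf_eq0 ?pnatr_eq0 ?andbF// rmorphXn rmorph_nat.
have conjE S x : (fourier_coef f S * walsh R S x)^*%R =
    (fourier_coef f S)^*%R * walsh R S x.
  rewrite rmorphM; congr (_ * _); rewrite ffunE rmorph_prod.
  by apply: eq_bigr => j _; rewrite rmorph_sign.
have fE x : (modc (f x) ^+ 2)%:C =
    \sum_S (fourier_coef f S)^*%R * (f x * walsh R S x).
  rewrite sqrE {2}(walsh_inversion f x) rmorph_sum mulr_sumr.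
  by apply: eq_bigr => S _; rewrite /= conjE mulrCA.
under eq_bigr => x _ do rewrite fE.
rewrite exchange_big /= mulr_sumr; apply: eq_bigr => S _.
by rewrite sqrE -mulr_sumr mulrCA mulrC.
Qed.

(** The operator [c(Delta)] of the functional calculus of the Laplacian. Composition, sums and
    scalings of such operators reduce to identities between scalar sequences. *)
Definition multiplier c f : {ffun cube n -> R[i]} :=
  [ffun x => \sum_(S : {set 'I_n}) (c #|S|)%:C * fourier_coef f S * walsh R S x].

Lemma fourier_coef_multiplier c f S :
  fourier_coef (multiplier c f) S = (c #|S|)%:C * fourier_coef f S.
Proof. exact: fourier_coef_walsh_sum. Qed.

Lemma eq_multiplier c c' f : c =1 c' -> multiplier c f = multiplier c' f.
Proof.
by move=> cc'; apply/ffunP => x; rewrite !ffunE; apply: eq_bigr => S _; rewrite cc'.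
Qed.

Lemma multiplier1 f : multiplier (fun=> 1) f = f.
Proof.
apply/ffunP => x; rewrite ffunE [RHS]walsh_inversion.
by apply: eq_bigr => S _; rewrite mul1r.
Qed.

Lemma multiplierM c c' f :
  multiplier c (multiplier c' f) = multiplier (fun m => c m * c' m) f.
Proof.
apply/ffunP => x; rewrite !ffunE; apply: eq_bigr => S _.
by rewrite fourier_coef_multiplier rmorphM /= mulrA.
Qed.

Lemma multiplierD c c' f :
  multiplier (fun m => c m + c' m) f = multiplier c f + multiplier c' f.
Proof.
apply/ffunP => x; rewrite !ffunE -big_split; apply: eq_bigr => S _.
by rewrite rmorphD /= !mulrDl.
Qed.

Lemma multiplierZ (a : R) c f :
  multiplier (fun m => a * c m) f = a%:C *: multiplier c f.
Proof.
apply/ffunP => x; rewrite !ffunE scaler_sumr; apply: eq_bigr => S _.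
by rewrite rmorphM /GRing.scale /= !mulrA.
Qed.

Lemma laplacian_multiplier f : laplacian f = multiplier (fun m => m%:R) f.
Proof.
apply/ffunP => x; rewrite sum_ffunE ffunE.
have diffE (j : 'I_n) S : (fourier_coef f S * walsh R S x -
      fourier_coef f S * walsh R S (flip j x)) / 2%:R =
    if j \in S then fourier_coef f S * walsh R S x else 0.
  rewrite walsh_flip; case: ifP => _; last by rewrite subrr mul0r.
  by rewrite mulrN opprK -mulr2n -[X in X / _]mulr_natr mulfK// pnatr_eq0.
under eq_bigr => j _.
  rewrite ffunE (walsh_inversion f x) (walsh_inversion f (flip j x)).
  rewrite -sumrB mulr_suml.
  under eq_bigr => S _ do rewrite diffE.
  over.
rewrite exchange_big /=; apply: eq_bigr => S _.
by rewrite -big_mkcond sumr_const rmorph_nat -mulrA mulr_natl.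
Qed.

(** Parseval reduces this to a bound on each coefficient; those of degree above [d] vanish. *)
Lemma cube_norm2_multiplier d c (a : R) f : 0 <= a ->
  (forall m, (m <= d)%N -> `|c m| <= a) -> deg_le d f ->
  cube_norm 2%:R (multiplier c f) <= a * cube_norm 2%:R f.
Proof.
move=> a0 ca df; have := fourier_coef_multiplier c f.
move: (multiplier c f) => g gE.
move: (cube_norm_ge0 2%:R f) (cube_norm_ge0 2%:R g) (parseval f) (parseval g).
move: (cube_norm 2%:R f) (cube_norm 2%:R g) => A B A0 B0 fE gE2.
rewrite -ler_sqr ?nnegrE ?mulr_ge0// exprMn fE gE2 mulr_sumr.
apply: ler_sum => S _.
rewrite gE ComplexField.Normc.normcM modc_real exprMn.
have [Sd|dS] := leqP #|S| d.
  by rewrite ler_wpM2r ?sqr_ge0// ler_sqr ?nnegrE// ca.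
by rewrite df// ComplexField.Normc.normc0 expr0n !mulr0.
Qed.

(** Each partial derivative is half the difference of two functions with the norm of [f]. The factor
    [n] is harmless: this bound only serves to make a remainder tend to [0] for fixed [n]. *)
Lemma cube_norm_laplacian (p : R) f : 1 <= p ->
  cube_norm p (laplacian f) <= n%:R * cube_norm p f.
Proof.
move=> p1; have p0 : 0 < p by apply: lt_le_trans p1.
apply: (le_trans (cube_norm_sum _ _ _ _ p1)).
rewrite -[X in X%:R * _]card_ord mulr_natl -sumr_const; apply: ler_sum => j _.
have -> : cube_partial j f =
    2%:R^-1 *: f + (- 2%:R^-1) *: [ffun x => f (flip j x)].
  by apply/ffunP => x; rewrite !ffunE /GRing.scale /= mulrBl mulNr !(mulrC 2%:R^-1).
apply: (le_trans (cube_normD _ _ _ p1)); rewrite !cube_normZ// cube_norm_flip normcN.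
rewrite ComplexField.Normc.normcV.
have -> : modc (2%:R : R[i]) = 2%:R by rewrite -[2%:R](rmorph_nat (real_complex R)) modc_real ger0_norm.
by rewrite -mulrDl -div1r -splitr mul1r.
Qed.

(* [1 + s Delta = (1 + s n / 2) - (s / 2) \sum_j T_j], where [T_j], composition
   with [flip j], is an isometry. *)
Lemma cube_norm_le_resolvent (p s : R) f : 1 <= p -> 0 <= s ->
  cube_norm p f <= cube_norm p (f + s%:C *: laplacian f).
Proof.
move=> p1 s0; have p0 : 0 < p by apply: lt_le_trans p1.
pose T := \sum_j [ffun x => f (flip j x)].
set g := f + _.
have E : (1 + s / 2%:R * n%:R)%:C *: f = g + (s / 2%:R)%:C *: T.
  apply/ffunP => x; rewrite !ffunE !sum_ffunE.
  under eq_bigr => j _ do rewrite ffunE.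
  under [in X in _ = _ + X]eq_bigr => j _ do rewrite ffunE.
  rewrite -mulr_suml sumrB sumr_const card_ord.
  rewrite rmorphD rmorph1 !rmorphM fmorphV !rmorph_nat /=.
  rewrite -[f x *+ n]mulr_natr.
  set Y := \sum_i _; rewrite /GRing.scale /=.
  by field.
have h0 : 0 <= s / 2%:R by rewrite divr_ge0.
have k0 : 0 <= 1 + s / 2%:R * n%:R by rewrite addr_ge0// mulr_ge0.
have hT : cube_norm p T <= n%:R * cube_norm p f.
  apply: (le_trans (cube_norm_sum _ _ _ _ p1)).
  under eq_bigr => j _ do rewrite cube_norm_flip.
  by rewrite sumr_const card_ord mulr_natl.
(* This yields [(1 + s n / 2) |f| <= |g| + (s / 2) n |f|] in norms, and the two terms in [n]
   cancel. *)
have := cube_normD p g ((s / 2%:R)%:C *: T) p1.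
rewrite -E (cube_normZ_real _ _ f p0 k0) (cube_normZ_real _ _ T p0 h0).
move: hT => /(ler_wpM2l h0).
move: (cube_norm p f) (cube_norm p g) (cube_norm p T) => A B C.
by rewrite mulrA mulrDl mul1r; lra.
Qed.

End Fourier.

(** * The resolvent of the Laplacian and the geometric series argument *)

Section Resolvent.
Context {R : realType} {n : nat}.
Implicit Types (f : {ffun cube n -> R[i]}) (p s M : R) (m : nat).

(** The previous bound is applied to the image of [f] under the resolvent, which [1 + s Delta] sends
    back to [f]. *)
Lemma cube_norm_resolvent p s f : 1 <= p -> 0 <= s ->
  cube_norm p (multiplier (fun m => (1 + s * m%:R)^-1) f) <= cube_norm p f.
Proof.
move=> p1 s0; pose J := fun m => (1 + s * m%:R)^-1.
apply: (le_trans (cube_norm_le_resolvent p s (multiplier J f) p1 s0)).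
suff -> : multiplier J f + s%:C *: laplacian (multiplier J f) = f by [].
rewrite laplacian_multiplier multiplierM -multiplierZ -multiplierD.
rewrite -[RHS]multiplier1; apply: eq_multiplier => m.
have d0 : 1 + s * m%:R != 0 by rewrite gt_eqF// ltr_pwDl// mulr_ge0.
by rewrite /J; move: (m%:R) d0 => r d0; field.
Qed.

(* The eigenvalue of [1 - (1 + s Delta)^-1] on Walsh functions of degree [m]. *)
Definition res_ratio s m : R := s * m%:R / (1 + s * m%:R).

Lemma res_ratio_ge0 s m : 0 <= s -> 0 <= res_ratio s m.
Proof. by move=> s0; rewrite divr_ge0 ?addr_ge0 ?mulr_ge0. Qed.

Lemma res_ratio_le s m : 0 <= s -> res_ratio s m <= s * m%:R.
Proof.
move=> s0; have sm0 : 0 <= s * m%:R by rewrite mulr_ge0.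
by rewrite ler_pdivrMr ?ltr_pwDl// ler_peMr// lerDl.
Qed.

Lemma cube_norm_res_ratio p s f : 1 <= p -> 0 <= s ->
  cube_norm p (multiplier (res_ratio s) f) <= 2%:R * cube_norm p f.
Proof.
move=> p1 s0; have p0 : 0 < p by apply: lt_le_trans p1.
pose J := fun m => (1 + s * m%:R)^-1.
have -> : multiplier (res_ratio s) f = f + (-1)%:C *: multiplier J f.
  rewrite -[X in X + _]multiplier1 -multiplierZ -multiplierD.
  apply: eq_multiplier => m; rewrite /res_ratio /J.
  have d0 : 1 + s * m%:R != 0 by rewrite gt_eqF// ltr_pwDl// mulr_ge0.
  by move: (m%:R) d0 => r d0; field.
apply: (le_trans (cube_normD p f ((-1)%:C *: multiplier J f) p1)).
rewrite (cube_normZ p _ (multiplier J f) p0) modc_real normrN1 mul1r.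
rewrite mulr_natl mulr2n lerD2l; exact: cube_norm_resolvent.
Qed.

Lemma cube_norm_res_ratioX p s f j : 1 <= p -> 0 <= s ->
  cube_norm p (multiplier (fun m => res_ratio s m ^+ j) f) <=
  2%:R ^+ j * cube_norm p f.
Proof.
move=> p1 s0; elim: j => [|j IH].
  by rewrite expr0 mul1r multiplier1.
have -> : multiplier (fun m => res_ratio s m ^+ j.+1) f =
    multiplier (res_ratio s) (multiplier (fun m => res_ratio s m ^+ j) f).
  by rewrite multiplierM; apply: eq_multiplier => m; rewrite exprS.
apply: (le_trans (cube_norm_res_ratio p s _ p1 s0)).
by rewrite exprS -mulrA ler_wpM2l.
Qed.

(* With [x = res_ratio s m] one has [s m = x + x (s m)]. Hence the norms [E_j]
   of the functions on the left satisfy [E_j <= E'_(j+1) + E_(j+1)], where [E']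
   is the same sequence for [k - 1]; unrolling gives a geometric series, whose
   remainder vanishes because [Delta] is bounded for fixed [n]. *)
Lemma cube_norm_res_ratioX_laplacian p s M f : 1 <= p -> 0 <= s -> 0 <= M ->
  (forall j, cube_norm p (multiplier (fun m => res_ratio s m ^+ j) f) <=
             2%:R ^- j * M) ->
  forall k j, cube_norm p
    (multiplier (fun m => res_ratio s m ^+ j * (s * m%:R) ^+ k) f) <=
    2%:R ^- j * M.
Proof.
move=> p1 s0 M0 base; have p0 : 0 < p by apply: lt_le_trans p1.
elim=> [|k IH] j.
  have -> : multiplier (fun m => res_ratio s m ^+ j * (s * m%:R) ^+ 0) f =
      multiplier (fun m => res_ratio s m ^+ j) f.
    by apply: eq_multiplier => m; rewrite mulr1.
  exact: base.
pose E i := cube_norm p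
  (multiplier (fun m => res_ratio s m ^+ i * (s * m%:R) ^+ k.+1) f).
have half i : 2%:R ^- i.+1 = 2%:R ^- i / 2%:R :> R by rewrite exprSr invfM.
(* One factor [s Delta] is split off and bounded at the cost of [s n]; the induction hypothesis on
   [k] supplies the decay [2 ^- i]. *)
have crude i : E i <= 2%:R ^- i * (s * n%:R * M).
  rewrite /E; set g := multiplier (fun m => res_ratio s m ^+ i * (s * m%:R) ^+ k) f.
  have -> : multiplier (fun m => res_ratio s m ^+ i * (s * m%:R) ^+ k.+1) f =
      s%:C *: laplacian g.
    rewrite laplacian_multiplier multiplierM -multiplierZ.
    by apply: eq_multiplier => m /=; rewrite exprS; ring.
  rewrite (cube_normZ_real p s (laplacian g) p0 s0).
  apply: (le_trans (ler_wpM2l s0 (cube_norm_laplacian p g p1))).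
  rewrite mulrA mulrCA ler_wpM2l ?mulr_ge0//; exact: IH.
have step i : E i <= 2%:R ^- i.+1 * M + E i.+1.
  rewrite /E; set u := fun m => res_ratio s m ^+ i.+1 * (s * m%:R) ^+ k.
  set v := fun m => res_ratio s m ^+ i.+1 * (s * m%:R) ^+ k.+1.
  have -> : multiplier (fun m => res_ratio s m ^+ i * (s * m%:R) ^+ k.+1) f =
      multiplier u f + multiplier v f.
    rewrite -multiplierD; apply: eq_multiplier => m; rewrite /u /v.
    have d0 : 1 + s * m%:R != 0 by rewrite gt_eqF// ltr_pwDl// mulr_ge0.
    have rE : s * m%:R = res_ratio s m + res_ratio s m * (s * m%:R).
      by rewrite /res_ratio; move: (m%:R) d0 => r d0; field.
    rewrite [in LHS]exprS {1}rE [res_ratio s m ^+ i.+1]exprS [in RHS]exprS.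
    by ring.
  apply: (le_trans (cube_normD p (multiplier u f) (multiplier v f) p1)).
  by rewrite lerD2r; exact: IH.
(* The shape of this bound is stable under [step]: the two halves of [2 ^- i * M] recombine, while
   the term carrying [n] is halved once more. At [N = 0] it is weaker than [crude]. *)
have unroll N i : E i <= 2%:R ^- i * M * (1 + s * n%:R * 2%:R ^- N).
  elim: N i => [|N IHN] i.
    rewrite expr0 invr1 mulr1; apply: (le_trans (crude i)).
    by rewrite mulrDr mulr1 [s * n%:R * M]mulrC mulrA lerDr mulr_ge0// invr_ge0 exprn_ge0.
  apply: (le_trans (step i)); apply: (le_trans (lerD (lexx _) (IHN i.+1))).
  rewrite !half le_eqVlt; apply/orP; left; apply/eqP.
  by move: (2%:R ^- i) (2%:R ^- N) => a b; field.
(* Letting [N] tend to infinity removes the dependence on [n]. *)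
pose u N : R := 2%:R ^- j * M * (1 + s * n%:R * 2%:R ^- N).
have cvgu : (u @ \oo --> 2%:R ^- j * M)%classic.
  rewrite -[X in (_ --> X)%classic]mulr1 -[X in _ * X](addr0 1).
  rewrite -[X in 1 + X](mulr0 (s * n%:R)).
  apply: cvgM; first exact: cvg_cst.
  apply: cvgD; first exact: cvg_cst.
  apply: cvgM; first exact: cvg_cst.
  rewrite (_ : (fun N => 2%:R ^- N) = GRing.exp (2%:R^-1 : R)); last first.
    by apply/funext => N; rewrite exprVn.
  by apply: cvg_expr; rewrite ger0_norm ?invr_ge0// invf_lt1// ltr1n.
rewrite -(cvg_lim (@Rhausdorff R) cvgu).
apply: limr_ge; first by apply/cvg_ex; eexists; exact: cvgu.
by apply: nearW => N; exact: unroll.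
Qed.

End Resolvent.

(** * Powers of the Laplacian between the [L^2] and [L^q] norms *)

Lemma iter_laplacian (R : realType) n k (f : {ffun cube n -> R[i]}) :
  iter k (@laplacian R n) f = multiplier (fun m => m%:R ^+ k) f.
Proof.
elim: k => [|k IH]; first by rewrite multiplier1.
rewrite iterS IH laplacian_multiplier multiplierM.
by apply: eq_multiplier => m; rewrite exprS.
Qed.

(** The constant is [a^-1], where [a] depends on [theta] alone, hence is fixed before [n], [d], [k]
    and [f]. The powers of [1 - (1 + s Delta)^-1] shrink like [a ^ j] in [L^2] and grow at most like
    [2 ^ j] in [L^q]; interpolation turns this into the decay [2 ^- j] that the series argument
    needs. *)
Lemma cube_norm_iter_laplacian (R : realType) (p q theta : R) :
  1 <= p -> 1 <= q -> 0 <= theta < 1 ->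
  p^-1 = theta / q + (1 - theta) / 2%:R ->
  exists2 C : R, 0 < C &
    forall (n d k : nat) (f : {ffun cube n -> R[i]}), (0 < d)%N -> deg_le d f ->
      cube_norm p (iter k (@laplacian R n) f) <=
      C ^+ k * d%:R ^+ k *
        (cube_norm 2%:R f `^ (1 - theta) * cube_norm q f `^ theta).
Proof.
move=> p1 q1 th01 pE.
have p0 : 0 < p by apply: lt_le_trans p1.
have q0 : 0 < q by apply: lt_le_trans q1.
have th1 : 0 < 1 - theta by rewrite subr_gt0; case/andP: th01.
pose a : R := 2%:R `^ (- (1 + theta) / (1 - theta)).
have a0 : 0 < a by rewrite powR_gt0.
(* [a] makes the interpolated norm of [1 - (1 + s Delta)^-1] equal to [1 / 2]. *)
have aE : a `^ (1 - theta) * 2%:R `^ theta = 2%:R^-1.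
  rewrite /a -powRrM divfK ?gt_eqF// -powRD; last by rewrite pnatr_eq0 implybT.
  by rewrite -powR_inv1//; congr (_ `^ _); ring.
have interp j x y A B : 0 <= x -> 0 <= y -> 0 <= A -> 0 <= B ->
    x <= a ^+ j * A -> y <= 2%:R ^+ j * B ->
    x `^ (1 - theta) * y `^ theta <= 2%:R ^- j * (A `^ (1 - theta) * B `^ theta).
  move=> x0 y0 A0 B0 xA yB.
  have e2 : 0 <= theta by case/andP: th01.
  apply: (@le_trans _ _ ((a ^+ j * A) `^ (1 - theta) * (2%:R ^+ j * B) `^ theta)).
    apply: ler_pM; rewrite ?powR_ge0//; apply: ge0_ler_powR => //;
      by rewrite ?nnegrE ?mulr_ge0 ?exprn_ge0 ?(ltW a0) ?(ltW th1).
  rewrite !powRM ?exprn_ge0 ?(ltW a0)//.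
  rewrite mulrACA -!powR_mulrn ?(ltW a0)// ![(_ `^ j%:R) `^ _]powRAC.
  by rewrite !powR_mulrn ?powR_ge0// -exprMn aE exprVn.
exists a^-1; first by rewrite invr_gt0.
move=> n d k f d0 fd; have dR : 0 < d%:R :> R by rewrite ltr0n.
(* With this scale every eigenvalue [res_ratio s m] with [m <= d] is at most [s m <= a]. *)
pose s := a / d%:R; have s0 : 0 < s by rewrite divr_gt0.
set M := _ `^ _ * _.
have M0 : 0 <= M by rewrite mulr_ge0 ?powR_ge0.
have base j : cube_norm p (multiplier (fun m => res_ratio s m ^+ j) f) <=
    2%:R ^- j * M.
  apply: (le_trans (cube_norm_interp p q theta _ p0 q0 th01 pE)).
  have h2 : cube_norm 2%:R (multiplier (fun m => res_ratio s m ^+ j) f) <=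
      a ^+ j * cube_norm 2%:R f.
    apply: (cube_norm2_multiplier d) => // [|m md]; first by rewrite exprn_ge0// ltW.
    rewrite ger0_norm ?exprn_ge0 ?res_ratio_ge0 ?(ltW s0)//.
    rewrite lerXn2r ?nnegrE ?res_ratio_ge0 ?(ltW s0) ?(ltW a0)//.
    apply: (le_trans (res_ratio_le s m (ltW s0))).
    by rewrite /s mulrAC ler_pdivrMr// ler_wpM2l ?(ltW a0)// ler_nat.
  have hq := cube_norm_res_ratioX q s f j q1 (ltW s0).
  rewrite /M; exact: interp (cube_norm_ge0 _ _) (cube_norm_ge0 _ _)
    (cube_norm_ge0 _ _) (cube_norm_ge0 _ _) h2 hq.
(* At [j = 0] this bounds the norm of [(s Delta)^k f] by [M]; dividing by [s ^ k] leaves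
   [s ^- k = (a^-1 d) ^ k]. *)
have := cube_norm_res_ratioX_laplacian p s M f p1 (ltW s0) M0 base k 0%N.
rewrite expr0 invr1 mul1r iter_laplacian.
have -> : multiplier (fun m => res_ratio s m ^+ 0 * (s * m%:R) ^+ k) f =
    (s ^+ k)%:C *: multiplier (fun m => m%:R ^+ k) f.
  by rewrite -multiplierZ; apply: eq_multiplier => m; rewrite expr0 mul1r exprMn.
rewrite (cube_normZ_real p (s ^+ k) _ p0 (exprn_ge0 _ (ltW s0))).
rewrite mulrC -ler_pdivlMr ?exprn_gt0// => /le_trans; apply.
rewrite mulrC ler_wpM2r//.
by rewrite -exprMn -exprVn /s invf_div mulrC.
Qed.

Theorem theorem1p3 (R : realType) (p eps : R) (hp : 1 < p) (heps : 0 < eps)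
    (heps2 : p < 2%:R -> eps < p - 1) :
  exists2 C : R, 0 < C &
    forall (n d : nat) (f : {ffun cube n -> R[i]}) (k : nat),
      (0 < n)%N -> (1 <= d <= n)%N -> deg_le d f ->
      (forall theta : R, 0 < theta < 1 ->
         p^-1 = theta / p_eps p eps + (1 - theta) / 2%:R ->
         cube_norm p (iter k (@laplacian R n) f) <=
           C ^+ k * d%:R ^+ k *
             (cube_norm 2%:R f `^ (1 - theta) *
              cube_norm (p_eps p eps) f `^ theta)) /\
      (2%:R <= p ->
         cube_norm p (iter k (@laplacian R n) f) <=
           C ^+ k * d%:R ^+ k * cube_norm (p + eps) f).
Proof.
set q := p_eps p eps.
have p0 : 0 < p by apply: lt_trans hp.
have q1 : 1 < q.
  rewrite /q /p_eps; have [p2|p2] /= := leP 2%:R p; first by lra.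
  by have := heps2 p2; lra.
have q0 : 0 < q by apply: lt_trans q1.
(* The solution of the affine relation between the exponents. It is [0] when [p = 2], a case that
   (i) excludes but (ii) includes. *)
pose theta0 := (p^-1 - 2%:R^-1) / (q^-1 - 2%:R^-1).
have [th01 qd] : 0 <= theta0 < 1 /\ q^-1 - 2%:R^-1 != 0.
  (* Either [2 <= p < q] or [q < p < 2]. The numerator and denominator of [theta0] have compatible
     signs in both cases, and the denominator is strictly larger in absolute value. *)
  rewrite /theta0; have [p2|p2] := leP 2%:R p.
    have qp : q^-1 < p^-1 by rewrite ltf_pV2// /q /p_eps p2 ltrDl.
    have p2' : p^-1 <= 2%:R^-1 by rewrite lef_pV2 ?posrE ?ltr0n.
    have d0 : q^-1 - 2%:R^-1 < 0 by rewrite subr_lt0 (lt_le_trans qp).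
    rewrite ltr_ndivrMr// mul1r ltrD2r qp andbT lt_eqF//.
    split => //; rewrite -mulrNN mulr_ge0 ?oppr_ge0 ?subr_le0//.
    by rewrite invr_le0 ltW.
  have qp : p^-1 < q^-1.
    by rewrite ltf_pV2// /q /p_eps leNgt p2 /= ltrBlDr ltrDl.
  have p2' : 2%:R^-1 < p^-1 by rewrite ltf_pV2 ?posrE ?ltr0n.
  have d0 : 0 < q^-1 - 2%:R^-1 by rewrite subr_gt0 (lt_trans p2').
  rewrite ltr_pdivrMr// mul1r ltrD2r qp gt_eqF// andbT; split => //.
  by rewrite divr_ge0 ?(ltW d0)// subr_ge0 ltW.
have thE : p^-1 = theta0 / q + (1 - theta0) / 2%:R.
  have -> : theta0 / q + (1 - theta0) / 2%:R =
      theta0 * (q^-1 - 2%:R^-1) + 2%:R^-1 by ring.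
  by rewrite /theta0 divfK// subrK.
have [C C0 CP] := cube_norm_iter_laplacian R p q theta0 (ltW hp) (ltW q1) th01 thE.
exists C => // n d f k _ /andP[d0 _] fd; split => [theta _ tE|p2].
  (* As [q] differs from [2], the relation has a single solution, so the constant obtained for
     [theta0] serves every admissible [theta]. *)
  have -> : theta = theta0; last exact: CP.
  by rewrite /theta0 tE -[LHS](mulfK qd); congr (_ / _); ring.
have qE : q = p + eps by rewrite /q /p_eps p2.
apply: (le_trans (CP n d k f d0 fd)); rewrite -qE.
rewrite ler_wpM2l ?mulr_ge0 ?exprn_ge0 ?(ltW C0)//.
have q2 : 2%:R <= q by rewrite qE (le_trans p2)// lerDl ltW.
have /andP[t0 t1] := th01; have t1' : 0 <= 1 - theta0 by rewrite subr_ge0 ltW.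
move: (cube_norm_ge0 2%:R f) (cube_norm_ge0 q f) (cube_norm2_le q f q2).
move: (cube_norm 2%:R f) (cube_norm q f) => A B A0 B0 AB.
(* The [L^2] norm [A] is replaced by the larger [L^q] norm [B], and the exponents [1 - theta0] and
   [theta0] add up to [1]. *)
have BE : B `^ (1 - theta0) * B `^ theta0 = B.
  by rewrite -powRD ?subrK ?powRr1// oner_eq0.
rewrite -[leRHS]BE ler_wpM2r ?powR_ge0//.
by apply: ge0_ler_powR; rewrite ?nnegrE.
Qed.
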